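(* Let $\Phi(L,W,S,B)$ with $L\le c_1$, $2\le W\le c_2N$, $S\le c_2N$, $1\le B\le c_2N$ for constants $c_1,c_2$ and $N$ sufficiently large, and let $\Delta\Phi(L,W,S,B)=\{\Delta F:F\in\Phi(L,W,S,B)\}$. Then there is a constant $C$ depending only on $d,c_1$ such that for all $\delta\in(0,1)$ $$\log\mathcal N\big(\delta,\Delta\Phi(L,W,S,B),\|\cdot\|_\infty\big)\le C\,S\big[\log(\delta^{-1})+3^L\log(WB)\big],$$ where $\|g\|_\infty=\sup_{x\in\Omega}|g(x)|$.
   Context: $\Omega=[0,1]^d$. For integers $L,W,S\ge1$ and $B>0$, $\Phi(L,W,S,B)$ is the set of functions $F:\mathbb R^d\to\mathbb R$ of the form $F=(\mathcal W^{(L)}\eta_3(\cdot)+b^{(L)})\circ\cdots\circ(\mathcal W^{(2)}\eta_3(\cdot)+b^{(2)})\circ(\mathcal W^{(1)}x+b^{(1)})$, where $\eta_3(t)=\max\{t,0\}^3$ acts componentwise, $\mathcal W^{(1)}\in\mathbb R^{W\times d}$, $b^{(1)}\in\mathbb R^W$, $\mathcal W^{(l)}\in\mathbb R^{W\times W}$, $b^{(l)}\in\mathbb R^W$ for $1<l<L$, $\mathcal W^{(L)}\in\mathbb R^{1\times W}$, $b^{(L)}\in\mathbb R$, the total number of nonzero entries of all $\mathcal W^{(l)},b^{(l)}$ is at most $S$, and all entries have absolute value at most $B$. $\Delta F=\sum_{j=1}^d\partial^2F/\partial x_j^2$ (well defined since $\eta_3\in C^2$). $\mathcal N(\delta,A,\|\cdot\|)$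 is the minimal number of $\|\cdot\|$-balls of radius $\delta$ centered in $A$ needed to cover $A$. *)

(* Defs.v *)
From HB Require Import structures.
From mathcomp Require Import all_boot all_order all_algebra.
From mathcomp Require Import all_classical all_reals all_analysis.
Unset Printing Implicit Defensive.
Import Order.TTheory GRing.Theory Num.Theory.
Import numFieldNormedType.Exports.
Local Open Scope classical_set_scope.
Local Open Scope ring_scope.

Section Nets.
Variable R : realType.

Definition eta3 (t : R) : R := (Num.max t 0) ^+ 3.

Definition ldim (d W L l : nat) : nat :=
  if l == 0%N then d else if l == L then 1%N else W.

(* Wt l i j = entry (i,j) of the weight matrix W^(l+1); bt l i = entry i of
   b^(l+1).  Only indices i < ldim (l+1), j < ldim l, l < L are meaningful. *)
(* Pre-activations after k affine layers (k >= 1). *)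
Fixpoint net_pre (d W : nat) (Wt : nat -> nat -> nat -> R) (bt : nat -> nat -> R)
    (x : 'rV[R]_d) (k : nat) : nat -> R :=
  match k with
  | 0%N => fun _ => 0
  | 1%N => fun i => \sum_(j < d) Wt 0%N i j * x ord0 j + bt 0%N i
  | k'.+1 => fun i => \sum_(j < W) Wt k' i j * eta3 (net_pre d W Wt bt x k' j) + bt k' i
  end.

Definition net (d W L : nat) Wt bt : 'rV[R]_d -> R :=
  fun x => net_pre d W Wt bt x L 0%N.

Definition nnz (d W L : nat) (Wt : nat -> nat -> nat -> R) (bt : nat -> nat -> R) : nat :=
  (\sum_(l < L) (\sum_(i < ldim d W L l.+1) \sum_(j < ldim d W L l) (Wt l i j != (0:R)%R)
               + \sum_(i < ldim d W L l.+1) (bt l i != (0:R)%R)))%N.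

Definition entries_bounded (d W L : nat) (Wt : nat -> nat -> nat -> R)
    (bt : nat -> nat -> R) (B : R) : Prop :=
  forall l : nat, (l < L)%N ->
    (forall i j : nat, (i < ldim d W L l.+1)%N -> (j < ldim d W L l)%N -> `|Wt l i j| <= B) /\
    (forall i : nat, (i < ldim d W L l.+1)%N -> `|bt l i| <= B).

Definition Phi (d L W S : nat) (B : R) : set ('rV[R]_d -> R) :=
  [set F | exists Wt bt, (nnz d W L Wt bt <= S)%N /\ entries_bounded d W L Wt bt B
                         /\ F = net d W L Wt bt].

Definition unit_vec (d : nat) (j : 'I_d) : 'rV[R]_d := delta_mx ord0 j.

Definition laplacian (d : nat) (F : 'rV[R]_d -> R) : 'rV[R]_d -> R :=
  fun x => \sum_(j < d) ('D_((unit_vec d j)) ('D_((unit_vec d j)) F)) x.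

Definition Omega (d : nat) : set 'rV[R]_d :=
  [set x | forall j : 'I_d, 0 <= x ord0 j <= 1].

Definition supnorm (d : nat) (g : 'rV[R]_d -> R) : \bar R :=
  ereal_sup [set (`|g x|)%:E | x in Omega d].

Definition is_cover (d : nat) (delta : R) (A : set ('rV[R]_d -> R))
    (n : nat) (c : 'I_n -> 'rV[R]_d -> R) : Prop :=
  (forall i, A (c i)) /\
  (forall f, A f -> exists i, (supnorm d (fun x => (f x - c i x)%R) <= delta%:E)%E).

(* Covering number N(delta, A, ||.||_oo): minimal number of centers needed
   (+oo if no finite cover exists). *)
Definition covering_number (d : nat) (delta : R) (A : set ('rV[R]_d -> R)) : \bar R :=
  ereal_inf [set (n%:R)%:E | n in [set n : nat | exists c, is_cover d delta A n c]].

End Nets.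
Arguments eta3 {R}.
Arguments net_pre {R}.
Arguments net {R}.
Arguments nnz {R}.
Arguments entries_bounded {R}.
Arguments Phi {R}.
Arguments unit_vec {R}.
Arguments laplacian {R}.
Arguments Omega {R}.
Arguments supnorm {R}.
Arguments is_cover {R}.
Arguments covering_number {R}.

(* Main.v *)
Require Import Defs.
From HB Require Import structures.
From mathcomp Require Import all_boot all_order all_algebra.
From mathcomp Require Import all_classical all_reals all_analysis.
From mathcomp Require Import ring lra.
Import Order.TTheory GRing.Theory Num.Theory.
Import numFieldNormedType.Exports.
Local Open Scope classical_set_scope.
Local Open Scope ring_scope.

(** Differentiating the forward recursion twice along a direction [v] gives closed
    recursions for the first and second directional derivatives of every
    pre-activation, and [laplacian] is the sum of the second ones at the output.
    With [G = 40 (d + 1) W B], one layer takes a bound [Z] on these jets on [Omega]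
    to [G Z^3], and the same recursion bounds the Lipschitz constant of the jets in
    the parameters; hence [Delta F] is [d G^(3^L)]-Lipschitz in the parameters.
    Quantising the parameters to accuracy [delta / (d G^(3^L))] and recording at
    most [S] of them with their positions leaves at most [(G^(6 3^L) / delta)^S]
    codes. One network per realised code gives a cover with centers in the class. *)

(** * Directional derivatives, and the derivatives of the activation *)

(** The two difference quotients coincide term by term. This transfers the one-variable chain rule
    to directional derivatives. *)
Lemma is_derive_line {R : realType} {V W : normedModType R} (f : V -> W)
    (x v : V) (df : W) :
  is_derive x v f df <-> is_derive (0 : R) (1 : R) (fun h : R => f (h *: v + x)) df.
Proof.
have e : 'D_v f x = 'D_(1 : R) (fun h : R => f (h *: v + x)) 0.
  rewrite /derive; set g1 := fun h => h^-1 *: _; set g2 := fun h => h^-1 *: _.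
  suff -> : g1 = g2 by [].
  by rewrite funeqE /g1 /g2 => h /=; rewrite addr0 scale0r add0r [_%:A]mulr1.
split=> -[fD fE].
  by apply: DeriveDef; [exact: (derivable1P f x v).1|rewrite -e].
by apply: DeriveDef; [exact: (derivable1P f x v).2|rewrite e].
Qed.

Lemma is_derive_comp_dir {R : realType} {V : normedModType R} {g : R -> R}
    {f : V -> R} {x v : V} {dg df : R} :
  is_derive (f x) 1 g dg -> is_derive x v f df ->
  is_derive x v (fun y => g (f y)) (dg * df).
Proof.
move=> gD /is_derive_line fD; apply/is_derive_line.
apply: (@is_derive1_comp _ g (fun h : R => f (h *: v + x))) => //.
by rewrite scale0r add0r.
Qed.

(** Dividing the remainder by [h] leaves an error [K * |h|]. This form suits functions defined by
    cases: an estimate by sign replaces the gluing of one-sided derivatives at the kink. *)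
Lemma is_derive_quadratic_remainder {R : realType} (g : R -> R) (t c K : R) :
  (forall h, `|h| <= 1 -> `|g (h + t) - g t - c * h| <= K * h ^+ 2) ->
  is_derive t (1 : R) g c.
Proof.
move=> gK.
have cvg_c : h^-1 *: ((g \o shift t) (h *: (1 : R)) - g t) @[h --> 0^'] --> c.
  apply/cvgrPdist_le => e e0.
  have K0 : 0 < `|K| + 1 by rewrite ltr_wpDl.
  (* The [1] keeps [h] within reach of the hypothesis; [|K| + 1] is positive whatever the sign of
     [K]. *)
  have m0 : 0 < Num.min 1 (e / (`|K| + 1)) by rewrite lt_min ltr01 divr_gt0.
  near=> h.
  have h0 : h != 0 by near: h; exact: nbhs_dnbhs_neq.
  have hm : `|h| < Num.min 1 (e / (`|K| + 1)).
    near: h; apply: dnbhs0_lt => //.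
  move: hm; rewrite lt_min => /andP[h1 he].
  rewrite /= [_%:A]mulr1.
  have -> : c - h^-1 *: (g (h + t) - g t) = - (h^-1 * (g (h + t) - g t - c * h)).
    by rewrite /GRing.scale /=; field.
  rewrite normrN normrM normfV ler_pdivrMl ?normr_gt0 //.
  apply: (le_trans (gK _ (ltW h1))).
  rewrite -real_normK ?num_real // expr2 mulrCA ler_wpM2l //.
  have : `|h| * (`|K| + 1) < e by rewrite -ltr_pdivlMr.
  have := ler_norm K; have := normr_ge0 h; nra.
by apply: DeriveDef; [apply/cvg_ex; exists c|exact: cvg_lim cvg_c].
Unshelve. all: by end_near. Qed.

Definition eta3_d1 {R : realType} (t : R) : R := 3 * Num.max t 0 ^+ 2.
Definition eta3_d2 {R : realType} (t : R) : R := 6 * Num.max t 0.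

Lemma is_derive_eta3 {R : realType} (t : R) : is_derive t (1 : R) eta3 (eta3_d1 t).
Proof.
(* When [t] and [h + t] are positive the remainder is [3 * t * h ^+ 2 + h ^+ 3], and [|h| <= 1]
   bounds the cube by [h ^+ 2]. When the signs differ, [|t| <= |h|]. *)
apply: (@is_derive_quadratic_remainder _ _ _ _ (3 * `|t| + 1)) => h h1.
rewrite /eta3 /eta3_d1 ler_norml; move: h1; rewrite ler_norml => /andP[h1 h2].
have hh := sqr_ge0 h.
have tK := mulr_ge0 (normr_ge0 t) hh.
case: (leP t 0) => t0; case: (leP (h + t) 0) => ht0.
- by apply/andP; split; nra.
- have s3 : (h + t) ^+ 3 <= (h + t) ^+ 2 by rewrite exprS ger_pMl ?exprn_gt0//; lra.
  have s2 : (h + t) ^+ 2 <= h ^+ 2 by rewrite lerXn2r ?nnegrE//; lra.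
  have s0 : 0 <= (h + t) ^+ 3 by apply/exprn_ge0/ltW.
  by apply/andP; split; lra.
- rewrite (gtr0_norm t0) in tK *.
  have th : 0 <= t * ((- t - h) * (- h)) by rewrite !mulr_ge0//; lra.
  have tt : 0 <= t ^+ 2 * (- t - h) by rewrite mulr_ge0 ?sqr_ge0//; lra.
  have t3 : 0 <= t ^+ 3 by apply/exprn_ge0/ltW.
  by apply/andP; split; lra.
- rewrite (gtr0_norm t0) in tK *.
  have hp : 0 <= h ^+ 2 * (1 + h) by rewrite mulr_ge0//; lra.
  have hm : 0 <= h ^+ 2 * (1 - h) by rewrite mulr_ge0//; lra.
  by apply/andP; split; lra.
Qed.

Lemma is_derive_eta3_d1 {R : realType} (t : R) :
  is_derive t (1 : R) eta3_d1 (eta3_d2 t).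
Proof.
(* On the positive side the remainder is exactly [3 * h ^+ 2]. *)
apply: (@is_derive_quadratic_remainder _ _ _ _ 3) => h h1.
rewrite /eta3_d2 /eta3_d1 ler_norml.
have hh := sqr_ge0 h.
case: (leP t 0) => t0; case: (leP (h + t) 0) => ht0; apply/andP; split; nra.
Qed.

Lemma is_derive_affine {R : realType} {V : normedModType R} (n : nat)
    (a : 'I_n -> R) (f : 'I_n -> V -> R) (df : 'I_n -> R) (c : R) (x v : V) :
  (forall j, is_derive x v (f j) (df j)) ->
  is_derive x v (fun y => \sum_(j < n) a j * f j y + c) (\sum_(j < n) a j * df j).
Proof.
move=> fD.
have -> : (fun y => \sum_(j < n) a j * f j y + c) =
    (\sum_(j < n) (a j \*: f j)) + cst c.
  by apply/funext => y; rewrite fctE fct_sumE.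
by rewrite -[X in is_derive _ _ _ X]addr0; apply: is_deriveD.
Qed.

Lemma is_derive_coord {R : realType} (d : nat) (x v : 'rV[R]_d) (j : 'I_d) :
  is_derive x v (fun y : 'rV[R]_d => y ord0 j) (v ord0 j).
Proof.
apply/is_derive_line; apply: (@is_derive_quadratic_remainder _ _ _ _ 0) => h _.
rewrite !mxE [X in `|X|](_ : _ = 0); last by ring.
by rewrite normr0 mul0r.
Qed.

(** * First and second derivatives of networks along a direction *)

Fixpoint net_d1 {R : realType} (d W : nat) (Wt : nat -> nat -> nat -> R)
    (bt : nat -> nat -> R) (v x : 'rV[R]_d) (k : nat) : nat -> R :=
  match k with
  | 0%N => fun _ => 0
  | 1%N => fun i => \sum_(j < d) Wt 0%N i j * v ord0 j
  | k'.+1 => fun i => \sum_(j < W) Wt k' i j *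
      (eta3_d1 (net_pre d W Wt bt x k' j) * net_d1 d W Wt bt v x k' j)
  end.

(** The first layer is affine, so the recursion starts from zero; afterwards each summand is the
    second derivative of a composition, [eta''(p) * p' ^ 2 + eta'(p) * p'']. *)
Fixpoint net_d2 {R : realType} (d W : nat) (Wt : nat -> nat -> nat -> R)
    (bt : nat -> nat -> R) (v x : 'rV[R]_d) (k : nat) : nat -> R :=
  match k with
  | 0%N | 1%N => fun _ => 0
  | k'.+1 => fun i => \sum_(j < W) Wt k' i j *
      (eta3_d2 (net_pre d W Wt bt x k' j) * net_d1 d W Wt bt v x k' j ^+ 2 +
       eta3_d1 (net_pre d W Wt bt x k' j) * net_d2 d W Wt bt v x k' j)
  end.

Lemma is_derive_net_pre {R : realType} (d W : nat) Wt bt (v x : 'rV[R]_d) k i :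
  is_derive x v (fun y => net_pre d W Wt bt y k i) (net_d1 d W Wt bt v x k i).
Proof.
elim: k i => [|[|k] IH] i /=; first exact: is_derive_cst.
  by apply: is_derive_affine => j; apply: is_derive_coord.
apply: is_derive_affine => j.
exact: is_derive_comp_dir (is_derive_eta3 _) (IH j).
Qed.

Lemma is_derive_net_d1 {R : realType} (d W : nat) Wt bt (v x : 'rV[R]_d) k i :
  is_derive x v (fun y => net_d1 d W Wt bt v y k i) (net_d2 d W Wt bt v x k i).
Proof.
elim: k i => [|[|k] IH] i; first exact: is_derive_cst.
  exact: is_derive_cst.
have := @is_derive_affine R _ W (fun j => Wt k.+1 i j)
  (fun j y => eta3_d1 (net_pre d W Wt bt y k.+1 j) * net_d1 d W Wt bt v y k.+1 j)
  (fun j => eta3_d2 (net_pre d W Wt bt x k.+1 j) * net_d1 d W Wt bt v x k.+1 j ^+ 2 +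
    eta3_d1 (net_pre d W Wt bt x k.+1 j) * net_d2 d W Wt bt v x k.+1 j) 0 x v.
(* Differentiation has removed the bias; a zero constant restores the shape expected by
   [is_derive_affine]. *)
have -> : (fun y => net_d1 d W Wt bt v y k.+2 i) =
    (fun y => \sum_(j < W) Wt k.+1 i j *
      (eta3_d1 (net_pre d W Wt bt y k.+1 j) * net_d1 d W Wt bt v y k.+1 j) + 0).
  by apply/funext => y; rewrite addr0.
apply => j.
have P := is_derive_comp_dir (is_derive_eta3_d1 _)
  (is_derive_net_pre d W Wt bt v x k.+1 j).
have Q := is_deriveM P (IH j).
apply: (is_derive_eq Q).
by rewrite /GRing.scale /=; ring.
Qed.

Lemma laplacian_net {R : realType} (d W L : nat) Wt bt (x : 'rV[R]_d) :
  laplacian d (net d W L Wt bt) x =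
  \sum_(j < d) net_d2 d W Wt bt (unit_vec d j) x L 0%N.
Proof.
apply: eq_bigr => j _.
(* The inner derivative is identified at every base point, since the outer one differentiates it as
   a function. *)
have -> : 'D_(unit_vec d j) (net d W L Wt bt) =
    (fun y => net_d1 d W Wt bt (unit_vec d j) y L 0%N).
  by apply/funext => y; have [_ <-] := is_derive_net_pre d W Wt bt (unit_vec d j) y L 0%N.
by have [_ <-] := is_derive_net_d1 d W Wt bt (unit_vec d j) x L 0%N.
Qed.

(** * Elementary inequalities and the growth of [jet_size] *)

Lemma norm_mul3_le {R : realType} (Z a b c : R) :
  `|a| <= Z -> `|b| <= Z -> `|c| <= Z -> `|a * b * c| <= Z ^+ 3.
Proof.
move=> aZ bZ cZ; rewrite !normrM exprSr expr2.
by apply: ler_pM; rewrite ?mulr_ge0//; apply: ler_pM.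
Qed.

(** Telescoping: the three factors are exchanged one at a time, each exchange costing
    [Z ^+ 2 * e]. *)
Lemma norm_mul3_sub_le {R : realType} (Z e a b c a' b' c' : R) :
  `|a| <= Z -> `|b| <= Z -> `|b'| <= Z -> `|c| <= Z ->
  `|a'| <= Z -> `|c'| <= Z ->
  `|a - a'| <= e -> `|b - b'| <= e -> `|c - c'| <= e ->
  `|a * b * c - a' * b' * c'| <= 3 * Z ^+ 2 * e.
Proof.
move=> aZ bZ bZ' cZ aZ' cZ' ae be ce.
have -> : a * b * c - a' * b' * c' =
  (a - a') * (b * c) + (b - b') * (a' * c) + (c - c') * (a' * b') by ring.
have M u v w : `|u| <= e -> `|v| <= Z -> `|w| <= Z -> `|u * (v * w)| <= e * Z ^+ 2.
  by move=> uh vh wh; rewrite !normrM expr2; apply: ler_pM; rewrite ?mulr_ge0//;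
    apply: ler_pM.
have h1 := M _ _ _ ae bZ cZ; have h2 := M _ _ _ be aZ' cZ.
have h3 := M _ _ _ ce aZ' bZ'.
apply: (le_trans (ler_normD _ _)); have := ler_normD ((a - a') * (b * c)) ((b - b') * (a' * c)).
lra.
Qed.

Lemma norm_max0_le {R : realType} (a : R) : `|Num.max a 0| <= `|a|.
Proof. by case: (leP a 0) => a0; rewrite ?normr0. Qed.

Lemma norm_max0_sub_le {R : realType} (a b : R) :
  `|Num.max a 0 - Num.max b 0| <= `|a - b|.
Proof.
have := ler_norm (a - b); have := ler_norm (- (a - b)); rewrite normrN.
by rewrite ler_norml; case: (leP a 0) => a0; case: (leP b 0) => b0;
  move=> *; apply/andP; split; lra.
Qed.

Lemma norm_sum_mul_le {R : realType} (n : nat) (a u : 'I_n -> R) (B X : R) :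
  (forall j, `|a j| <= B) -> (forall j, `|u j| <= X) ->
  `|\sum_(j < n) a j * u j| <= n%:R * (B * X).
Proof.
move=> aB uX; apply: (le_trans (ler_norm_sum _ _ _)).
rewrite mulr_natl -[X in _ *+ X]card_ord -sumr_const.
by apply: ler_sum => j _; rewrite normrM ler_pM.
Qed.

Lemma norm_sum_mul_sub_le {R : realType} (n : nat) (a u a' u' : 'I_n -> R)
    (B X e Y : R) :
  (forall j, `|a' j| <= B) -> (forall j, `|u j| <= X) ->
  (forall j, `|a j - a' j| <= e) -> (forall j, `|u j - u' j| <= Y) ->
  `|\sum_(j < n) a j * u j - \sum_(j < n) a' j * u' j| <=
    n%:R * (e * X + B * Y).
Proof.
move=> aB uX ae uY.
have -> : \sum_(j < n) a j * u j - \sum_(j < n) a' j * u' j =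
    \sum_(j < n) (a j - a' j) * u j + \sum_(j < n) a' j * (u j - u' j).
  rewrite -big_split -sumrB; apply: eq_bigr => j _ /=; ring.
by rewrite mulrDr (le_trans (ler_normD _ _))// lerD// norm_sum_mul_le.
Qed.

(* [G * Z ^+ 3] dominates both layer estimates: 9 W B Z^3 + B for the jets and
   (36 W B Z^3 + 1) e for their differences. *)
Fixpoint jet_size {R : realType} (G : R) (k : nat) : R :=
  if k is k'.+1 then G * jet_size G k' ^+ 3 else 1.

Lemma jet_size_ge1 {R : realType} (G : R) k : 1 <= G -> 1 <= jet_size G k.
Proof. by move=> G1; elim: k => //= k IH; rewrite mulr_ege1// exprn_ege1. Qed.

Lemma jet_size_le {R : realType} (G : R) k :
  1 <= G -> jet_size G k <= G ^+ (3 ^ k).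
Proof.
move=> G1; have G0 : 0 <= G by apply: le_trans G1.
(* The extra factor [G] makes the induction close: [G * (G * Z ^+ 3) <= (G * Z) ^+ 3] because
   [G >= 1]. *)
suff : G * jet_size G k <= G ^+ (3 ^ k).
  by apply: le_trans; rewrite ler_peMl// (le_trans ler01)// jet_size_ge1.
elim: k => [|k IH] /=; first by rewrite mulr1.
have Z0 : 0 <= jet_size G k by rewrite (le_trans ler01)// jet_size_ge1.
rewrite expnSr exprM; apply: (@le_trans _ _ ((G * jet_size G k) ^+ 3)); last first.
  by rewrite lerXn2r// nnegrE ?mulr_ge0// exprn_ge0.
rewrite exprMn mulrA ler_wpM2r ?exprn_ge0//.
by rewrite -expr2 ler_weXn2l//.
Qed.

(** * Size of the jets and their sensitivity to the parameters *)

(** With [m] the positive part of [p], every term is a multiple of a product of three factors of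
    size [Z]: [m * m * m], [m * m * q], [m * q * q] or [m * m * r]. The constant is [9 = 6 + 3],
    from the second derivative. *)
Lemma activation_jet_bound {R : realType} (Z p q r : R) :
  `|p| <= Z -> `|q| <= Z -> `|r| <= Z ->
  [/\ `|eta3 p| <= 9 * Z ^+ 3, `|eta3_d1 p * q| <= 9 * Z ^+ 3 &
      `|eta3_d2 p * q ^+ 2 + eta3_d1 p * r| <= 9 * Z ^+ 3].
Proof.
move=> pZ qZ rZ; have Z0 : 0 <= Z by apply: le_trans pZ.
have Z3 : 0 <= Z ^+ 3 by rewrite exprn_ge0.
rewrite /eta3 /eta3_d1 /eta3_d2; set m := Num.max p 0.
have mZ : `|m| <= Z by apply: le_trans pZ; exact: norm_max0_le.
have h1 := norm_mul3_le _ _ _ _ mZ mZ mZ.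
have h2 := norm_mul3_le _ _ _ _ mZ mZ qZ.
have h3 := norm_mul3_le _ _ _ _ mZ qZ qZ.
have h4 := norm_mul3_le _ _ _ _ mZ mZ rZ.
have -> : m ^+ 3 = m * m * m by ring.
have -> : 3 * m ^+ 2 * q = 3 * (m * m * q) by ring.
have -> : 6 * m * q ^+ 2 + 3 * m ^+ 2 * r = 6 * (m * q * q) + 3 * (m * m * r) by ring.
move: h1 h2 h3 h4; rewrite !ler_norml => /andP[? ?] /andP[? ?] /andP[? ?] /andP[? ?].
by split; apply/andP; split; lra.
Qed.

(** The same cubic terms are compared factor by factor; [27] is [6 + 3] times the telescoping
    constant [3], and the positive part is 1-Lipschitz. *)
Lemma activation_jet_sub_le {R : realType} (Z e p q r p' q' r' : R) :
  `|p| <= Z -> `|q| <= Z -> `|r| <= Z -> `|p'| <= Z -> `|q'| <= Z -> `|r'| <= Z ->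
  `|p - p'| <= e -> `|q - q'| <= e -> `|r - r'| <= e ->
  [/\ `|eta3 p - eta3 p'| <= 27 * Z ^+ 2 * e,
      `|eta3_d1 p * q - eta3_d1 p' * q'| <= 27 * Z ^+ 2 * e &
      `|eta3_d2 p * q ^+ 2 + eta3_d1 p * r - (eta3_d2 p' * q' ^+ 2 + eta3_d1 p' * r')|
        <= 27 * Z ^+ 2 * e].
Proof.
move=> pZ qZ rZ pZ' qZ' rZ' pe qe re; have e0 : 0 <= e by apply: le_trans pe.
have Z2 : 0 <= Z ^+ 2 * e by rewrite mulr_ge0 ?exprn_ge0// (le_trans _ pZ).
rewrite /eta3 /eta3_d1 /eta3_d2; set m := Num.max p 0; set m' := Num.max p' 0.
have mZ : `|m| <= Z by apply: le_trans pZ; exact: norm_max0_le.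
have mZ' : `|m'| <= Z by apply: le_trans pZ'; exact: norm_max0_le.
have me : `|m - m'| <= e by apply: le_trans pe; exact: norm_max0_sub_le.
have h1 := norm_mul3_sub_le _ _ _ _ _ _ _ _ mZ mZ mZ' mZ mZ' mZ' me me me.
have h2 := norm_mul3_sub_le _ _ _ _ _ _ _ _ mZ mZ mZ' qZ mZ' qZ' me me qe.
have h3 := norm_mul3_sub_le _ _ _ _ _ _ _ _ mZ qZ qZ' qZ mZ' qZ' me qe qe.
have h4 := norm_mul3_sub_le _ _ _ _ _ _ _ _ mZ mZ mZ' rZ mZ' rZ' me me re.
have -> : m ^+ 3 - m' ^+ 3 = m * m * m - m' * m' * m' by ring.
have -> : 3 * m ^+ 2 * q - 3 * m' ^+ 2 * q' = 3 * (m * m * q - m' * m' * q') by ring.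
have -> : 6 * m * q ^+ 2 + 3 * m ^+ 2 * r - (6 * m' * q' ^+ 2 + 3 * m' ^+ 2 * r') =
  6 * (m * q * q - m' * q' * q') + 3 * (m * m * r - m' * m' * r') by ring.
move: h1 h2 h3 h4; rewrite !ler_norml => /andP[? ?] /andP[? ?] /andP[? ?] /andP[? ?].
by split; apply/andP; split; lra.
Qed.

Lemma net_jet_bound {R : realType} (d W L : nat) (B : R) Wt bt (v x : 'rV[R]_d) :
  (0 < W)%N -> 1 <= B -> entries_bounded d W L Wt bt B ->
  (forall j, `|v ord0 j| <= 1) -> (forall j, `|x ord0 j| <= 1) ->
  forall k i, (0 < k <= L)%N -> (i < ldim d W L k)%N ->
  let Z := jet_size (40 * d.+1%:R * (W%:R * B)) k in
  [/\ `|net_pre d W Wt bt x k i| <= Z, `|net_d1 d W Wt bt v x k i| <= Z &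
      `|net_d2 d W Wt bt v x k i| <= Z].
Proof.
move=> W0 B1 WbB v1 x1.
have d1 : 1 <= d.+1%:R :> R by rewrite ler1n.
have WB1 : 1 <= W%:R * B by rewrite mulr_ege1// ler1n.
have WBB : B <= W%:R * B by rewrite ler_peMl ?(le_trans ler01)// ler1n.
set G := 40 * _ * _.
have G40 : 40 * (W%:R * B) <= G.
  by rewrite /G -mulrA ler_pM2l// ler_peMl// (le_trans ler01).
have G1 : 1 <= G by move: (G40); lra.
elim=> [//|[|k] IH] i /andP[_ kL] iW Z.
  have [WB bB] := WbB _ kL.
  (* The input layer has [d] weights and one bias per unit, which the factor [d.+1] of [G]
     absorbs. *)
  have dB : d%:R * (B * 1) + B <= Z.
    rewrite /Z /= expr1n !mulr1 /G mulrAC.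
    have -> : d%:R * B + B = B * d.+1%:R by rewrite -natr1; ring.
    by rewrite ler_wpM2r ?(le_trans ler01)//; move: WBB WB1; lra.
  have sB (u : 'I_d -> R) : (forall j, `|u j| <= 1) ->
      `|\sum_(j < d) Wt 0%N i j * u j| <= d%:R * (B * 1).
    by move=> u1; apply: norm_sum_mul_le => // j; apply: WB.
  split=> /=.
  - by apply: (le_trans (ler_normD _ _)); apply: le_trans dB; rewrite lerD ?sB ?bB.
  - by apply: le_trans dB; apply: le_trans (sB _ v1) _; rewrite lerDl (le_trans ler01).
  - by rewrite normr0 (le_trans ler01)// (jet_size_ge1 _ 1%N).
have [WB bB] := WbB _ kL.
(* Since [0 < k.+1 < L], this layer is hidden, so the index range of the weights agrees with the sum
   over ['I_W]. *)
have kW : ldim d W L k.+1 = W by rewrite /ldim /= ltn_eqF.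
rewrite kW in WB.
set Y := jet_size G k.+1.
have act (j : 'I_W) : [/\ `|net_pre d W Wt bt x k.+1 j| <= Y,
    `|net_d1 d W Wt bt v x k.+1 j| <= Y & `|net_d2 d W Wt bt v x k.+1 j| <= Y].
  by apply: IH; rewrite ?kW //= ltnW.
have Y3 : 1 <= Y ^+ 3 by rewrite exprn_ege1// jet_size_ge1.
have ZE : W%:R * (B * (9 * Y ^+ 3)) + B <= Z.
  have -> : Z = G * Y ^+ 3 by [].
  have : W%:R * B <= W%:R * B * Y ^+ 3 by rewrite ler_peMr// (le_trans ler01).
  have : 40 * (W%:R * B) * Y ^+ 3 <= G * Y ^+ 3.
    by rewrite ler_wpM2r// (le_trans ler01).
  move: WB1 WBB Y3; lra.
have s (u : 'I_W -> R) : (forall j, `|u j| <= 9 * Y ^+ 3) ->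
    `|\sum_(j < W) Wt k.+1 i j * u j| <= W%:R * (B * (9 * Y ^+ 3)).
  by move=> uX; apply: norm_sum_mul_le => // j; apply: WB.
split.
- apply: (le_trans (ler_normD _ _)); apply: le_trans ZE; rewrite lerD ?bB//.
  by apply: s => j; have [p q r] := act j; have [] := activation_jet_bound _ _ _ _ p q r.
- apply: le_trans ZE; rewrite ler_wpDr ?(le_trans ler01)//.
  by apply: s => j; have [p q r] := act j; have [] := activation_jet_bound _ _ _ _ p q r.
- apply: le_trans ZE; rewrite ler_wpDr ?(le_trans ler01)//.
  by apply: s => j; have [p q r] := act j; have [] := activation_jet_bound _ _ _ _ p q r.
Qed.

(** Applying [entries_bounded] to the differences restricts the comparison to meaningful indices. *)
Definition entries_close {R : realType} (d W L : nat)
    (Wt : nat -> nat -> nat -> R) (bt : nat -> nat -> R) Wt' bt' (e : R) : Prop :=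
  entries_bounded d W L (fun l i j => Wt l i j - Wt' l i j)
    (fun l i => bt l i - bt' l i) e.

(** A cubic activation turns jets of size [Y] differing by [Y * e] into values differing by a
    multiple of [Y ^+ 2 * (Y * e)]. Perturbing the weights costs a multiple of [Y ^+ 3 * e] as well,
    so Lipschitz constants grow by the recursion of the sizes. *)
Lemma net_jet_sub_le {R : realType} (d W L : nat) (B e : R) Wt bt Wt' bt'
    (v x : 'rV[R]_d) :
  (0 < W)%N -> 1 <= B -> 0 <= e -> entries_bounded d W L Wt bt B ->
  entries_bounded d W L Wt' bt' B -> entries_close d W L Wt bt Wt' bt' e ->
  (forall j, `|v ord0 j| <= 1) -> (forall j, `|x ord0 j| <= 1) ->
  forall k i, (0 < k <= L)%N -> (i < ldim d W L k)%N ->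
  let Z := jet_size (40 * d.+1%:R * (W%:R * B)) k in
  [/\ `|net_pre d W Wt bt x k i - net_pre d W Wt' bt' x k i| <= Z * e,
      `|net_d1 d W Wt bt v x k i - net_d1 d W Wt' bt' v x k i| <= Z * e &
      `|net_d2 d W Wt bt v x k i - net_d2 d W Wt' bt' v x k i| <= Z * e].
Proof.
move=> W0 B1 e0 WbB WbB' Wbe v1 x1.
have B0 : 0 <= B by exact: le_trans B1.
have d1 : 1 <= d.+1%:R :> R by rewrite ler1n.
have W1 : 1 <= W%:R :> R by rewrite ler1n.
have WB1 : 1 <= W%:R * B by rewrite mulr_ege1// ler1n.
have WBW : W%:R <= W%:R * B by rewrite ler_peMr// (le_trans ler01).
have bound := net_jet_bound d W L B _ _ v x W0 B1 WbB v1 x1.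
have bound' := net_jet_bound d W L B _ _ v x W0 B1 WbB' v1 x1.
set G := 40 * _ * _ in bound bound' *.
have G40 : 40 * (W%:R * B) <= G.
  by rewrite /G -mulrA ler_pM2l// ler_peMl// (le_trans ler01).
have G1 : 1 <= G by move: (G40); lra.
elim=> [//|[|k] IH] i /andP[_ kL] iW Z.
  have [WB bB] := Wbe _ kL.
  (* Both networks receive the same point and direction, hence the zero: only the parameters differ
     in the first layer. *)
  have dB : d%:R * (e * 1 + B * 0) + e <= Z * e.
    rewrite /Z /= expr1n !mulr1 mulr0 addr0 /G.
    have -> : d%:R * e + e = d.+1%:R * e by rewrite -natr1; ring.
    rewrite ler_wpM2r// mulrAC ler_peMl// ?(le_trans ler01)//.
    by move: WB1; lra.
  have sB (u : 'I_d -> R) : (forall j, `|u j| <= 1) ->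
      `|\sum_(j < d) Wt 0%N i j * u j - \sum_(j < d) Wt' 0%N i j * u j|
        <= d%:R * (e * 1 + B * 0).
    move=> u1; have [WB' _] := WbB' _ kL.
    apply: (norm_sum_mul_sub_le _ _ _ _ _ B 1 e 0) => // j; [exact: WB'|exact: WB|].
    by rewrite subrr normr0.
  split=> /=.
  - rewrite opprD addrACA; apply: (le_trans (ler_normD _ _)); apply: le_trans dB.
    by rewrite lerD ?sB ?bB.
  - by apply: le_trans dB; apply: le_trans (sB _ v1) _; rewrite lerDl.
  - rewrite subrr normr0 mulr_ge0// (le_trans ler01)//.
    exact: (jet_size_ge1 _ 1%N).
have [WB bB] := Wbe _ kL.
have [WB' _] := WbB' _ kL.
have kW : ldim d W L k.+1 = W by rewrite /ldim /= ltn_eqF.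
rewrite kW in WB WB'.
set Y := jet_size G k.+1.
have k0L : (0 < k.+1 <= L)%N by exact: ltnW.
have jW (j : 'I_W) : (j < ldim d W L k.+1)%N by rewrite kW.
have act (j : 'I_W) := bound k.+1 j k0L (jW j).
have act' (j : 'I_W) := bound' k.+1 j k0L (jW j).
have {}IH (j : 'I_W) := IH j k0L (jW j).
have Y0 : 0 <= Y by rewrite (le_trans ler01)// jet_size_ge1.
have Y3 : 1 <= Y ^+ 3 by rewrite exprn_ege1// jet_size_ge1.
have ZE : W%:R * (e * (9 * Y ^+ 3) + B * (27 * Y ^+ 2 * (Y * e))) + e <= Z * e.
  have -> : Z = G * Y ^+ 3 by [].
  have -> : W%:R * (e * (9 * Y ^+ 3) + B * (27 * Y ^+ 2 * (Y * e))) + e =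
    (9 * (W%:R * Y ^+ 3) + 27 * (W%:R * B * Y ^+ 3) + 1) * e by ring.
  rewrite ler_wpM2r//.
  have Y30 : 0 <= Y ^+ 3 by exact: le_trans Y3.
  have : 1 <= W%:R * B * Y ^+ 3 by rewrite mulr_ege1.
  have : W%:R * Y ^+ 3 <= W%:R * B * Y ^+ 3 by rewrite ler_wpM2r.
  have : 40 * (W%:R * B) * Y ^+ 3 <= G * Y ^+ 3 by rewrite ler_wpM2r.
  lra.
have s (u u' : 'I_W -> R) : (forall j, `|u j| <= 9 * Y ^+ 3) ->
    (forall j, `|u j - u' j| <= 27 * Y ^+ 2 * (Y * e)) ->
    `|\sum_(j < W) Wt k.+1 i j * u j - \sum_(j < W) Wt' k.+1 i j * u' j|
      <= W%:R * (e * (9 * Y ^+ 3) + B * (27 * Y ^+ 2 * (Y * e))).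
  by move=> uX uY; apply: norm_sum_mul_sub_le => // j; [apply: WB'|apply: WB].
split.
- have -> : net_pre d W Wt bt x k.+2 i - net_pre d W Wt' bt' x k.+2 i =
      (\sum_(j < W) Wt k.+1 i j * eta3 (net_pre d W Wt bt x k.+1 j) -
       \sum_(j < W) Wt' k.+1 i j * eta3 (net_pre d W Wt' bt' x k.+1 j)) +
      (bt k.+1 i - bt' k.+1 i) by rewrite addrACA -opprD.
  apply: (le_trans (ler_normD _ _)).
  apply: le_trans ZE; rewrite lerD ?bB//.
  apply: s => j; have [p q r] := act j.
    by have [] := activation_jet_bound _ _ _ _ p q r.
  have [p' q' r'] := act' j; have [pe qe re] := IH j.
  by have [] := activation_jet_sub_le _ _ _ _ _ _ _ _ p q r p' q' r' pe qe re.
- apply: le_trans ZE; rewrite ler_wpDr//.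
  apply: s => j; have [p q r] := act j.
    by have [] := activation_jet_bound _ _ _ _ p q r.
  have [p' q' r'] := act' j; have [pe qe re] := IH j.
  by have [] := activation_jet_sub_le _ _ _ _ _ _ _ _ p q r p' q' r' pe qe re.
- apply: le_trans ZE; rewrite ler_wpDr//.
  apply: s => j; have [p q r] := act j.
    by have [] := activation_jet_bound _ _ _ _ p q r.
  have [p' q' r'] := act' j; have [pe qe re] := IH j.
  by have [] := activation_jet_sub_le _ _ _ _ _ _ _ _ p q r p' q' r' pe qe re.
Qed.

Lemma supnorm_le {R : realType} (d : nat) (g : 'rV[R]_d -> R) (c : R) :
  (forall x, Omega d x -> `|g x| <= c) -> (supnorm d g <= c%:E)%E.
Proof. by move=> gc; apply/ereal_supP => _ [x Ox <-]; rewrite lee_fin gc. Qed.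

Lemma laplacian_net_sub_le {R : realType} (d W L : nat) (B e : R) Wt bt Wt' bt'
    (x : 'rV[R]_d) :
  (0 < W)%N -> (0 < L)%N -> 1 <= B -> 0 <= e -> entries_bounded d W L Wt bt B ->
  entries_bounded d W L Wt' bt' B -> entries_close d W L Wt bt Wt' bt' e ->
  Omega d x ->
  `|laplacian d (net d W L Wt bt) x - laplacian d (net d W L Wt' bt') x| <=
    d%:R * ((40 * d.+1%:R * (W%:R * B)) ^+ (3 ^ L) * e).
Proof.
move=> W0 L0 B1 e0 WB WB' We Ox.
rewrite !laplacian_net -sumrB; apply: (le_trans (ler_norm_sum _ _ _)).
rewrite mulr_natl -[X in _ *+ X]card_ord -sumr_const; apply: ler_sum => j _.
have v1 (k : 'I_d) : `|unit_vec d j ord0 k : R| <= 1.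
  by rewrite mxE; case: (_ && _); rewrite ?normr1 ?normr0.
have x1 (k : 'I_d) : `|x ord0 k| <= 1 by have /andP[x0 x1] := Ox k; rewrite ger0_norm.
have LL : (0 < L <= L)%N by rewrite L0 leqnn.
have L1 : (0 < ldim d W L L)%N by rewrite /ldim eqxx gtn_eqF.
have [_ _] := net_jet_sub_le d W L B e _ _ _ _ _ x W0 B1 e0 WB WB' We v1 x1 L 0%N LL L1.
move=> /le_trans; apply; rewrite ler_wpM2r// jet_size_le//.
have : 1 <= W%:R * B by rewrite mulr_ege1// ler1n.
have : 1 <= d.+1%:R :> R by rewrite ler1n.
by move=> d1 WB1; rewrite mulr_ege1// mulr_ege1//; lra.
Qed.

(** * Covers obtained from finite codes *)

(** Functions sharing a code are [delta]-close, so any one of them can serve as center for all. The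
    code is a relation because one function may be realised by several parameter choices. *)
Lemma covering_number_le_card {R : realType} (d : nat) (delta : R)
    (A : set ('rV[R]_d -> R)) (T : finType) (code : ('rV[R]_d -> R) -> T -> Prop) :
  A !=set0 -> (forall f, A f -> exists t, code f t) ->
  (forall f g t, A f -> A g -> code f t -> code g t ->
    (supnorm d (fun x => (f x - g x)%R) <= delta%:E)%E) ->
  (covering_number d delta A <= (#|T|%:R)%:E)%E.
Proof.
move=> [f0 Af0] coded close; apply: ge_ereal_inf; exists (#|T|%:R)%:E => //.
exists #|T| => //=.
(* Codes that no member of [A] realises receive the default center [f0], so that all centers lie in
   [A]. *)
have rep (t : T) : exists f, A f /\ ((exists g, A g /\ code g t) -> code f t).
  have [[g [Ag gt]]|no] := pselect (exists g, A g /\ code g t); first by exists g.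
  by exists f0; split.
have [c cP] := choice rep.
exists (fun i => c (enum_val i)); split=> [i|f Af]; first by have [] := cP (enum_val i).
have [t ft] := coded _ Af; exists (enum_rank t); rewrite enum_rankK.
have [Act ctt] := cP t; apply: (close _ _ t) => //.
by apply: ctt; exists f.
Qed.

(** * Parameter tables, their quantisation and the resulting cover *)

Lemma sum_ord_widen_if (m n : nat) (F : nat -> nat) : (m <= n)%N ->
  (\sum_(i < n) (if i < m then F i else 0) = \sum_(i < m) F i)%N.
Proof. by move=> mn; rewrite -big_mkcond/= [RHS](big_ord_widen n). Qed.

Lemma leq_ldim (d W L l : nat) : (0 < W)%N -> (ldim d W L l <= W + d)%N.
Proof.
move=> W0; rewrite /ldim; case: ifP => _; first exact: leq_addl.
by case: ifP => _; [rewrite ltn_addr|exact: leq_addr].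
Qed.

(* All parameters in one table, padded by zeros; the last column holds biases. *)
Definition net_entry {R : realType} (d W L : nat) (Wt : nat -> nat -> nat -> R)
    (bt : nat -> nat -> R) (p : 'I_L * ('I_(W + d) * 'I_(W + d).+1)) : R :=
  let: (l, (i, j)) := p in
  if (i < ldim d W L l.+1)%N then
    if j == ord_max then bt l i else if (j < ldim d W L l)%N then Wt l i j else 0
  else 0.

Lemma card_net_entry_neq0 {R : realType} (d W L : nat) Wt bt : (0 < W)%N ->
  (#|[pred p | net_entry d W L Wt bt p != 0%R :> R]| <= nnz d W L Wt bt)%N.
Proof.
move=> W0.
have -> : #|[pred p | net_entry d W L Wt bt p != 0%R :> R]| =
    (\sum_(l < L) \sum_(i < W + d) \sum_(j < (W + d).+1)
      (net_entry d W L Wt bt (l, (i, j)) != 0%R :> R))%N.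
  under [RHS]eq_bigr do rewrite pair_bigA.
  rewrite pair_bigA -sum1_card big_mkcond /=.
  by apply: eq_bigr => -[l [i j]] _ /=; rewrite inE; case: (_ == _).
apply: leq_sum => l _.
rewrite -big_split /=.
rewrite -(@sum_ord_widen_if (ldim d W L l.+1) (W + d) (fun i =>
  \sum_(j < ldim d W L l) (Wt l i j != 0%R :> R) + (bt l i != 0%R :> R))%N) ?leq_ldim//.
apply: leq_sum => i _; case: ifP => il; last first.
  by rewrite big1// => j _; rewrite eqxx.
(* Splitting off the last column isolates the bias; the remaining columns hold weights and padding
   zeros. *)
rewrite big_ord_recr /= eqxx leq_add//.
rewrite -(@sum_ord_widen_if (ldim d W L l) (W + d) (fun j => (Wt l i j != 0%R :> R) : nat))
  ?leq_ldim//.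
apply: leq_sum => j _.
have -> : (widen_ord (leqnSn (W + d)) j == ord_max) = false.
  by apply/negbTE; rewrite -val_eqE/= neq_ltn ltn_ord.
by case: ifP => _; rewrite ?eqxx.
Qed.

Lemma net_entry_bounded {R : realType} (d W L : nat) (B : R) Wt bt p : 0 <= B ->
  entries_bounded d W L Wt bt B -> `|net_entry d W L Wt bt p| <= B.
Proof.
case: p => l [i j] B0 WbB; rewrite /net_entry.
have [WB bB] := WbB l (ltn_ord l).
case: ifP => il; last by rewrite normr0.
case: ifP => _; first exact: bB.
by case: ifP => jl; [exact: WB|rewrite normr0].
Qed.

Lemma entries_close_net_entry {R : realType} (d W L : nat) (e : R) Wt bt Wt' bt' :
  (0 < W)%N ->
  (forall p, `|net_entry d W L Wt bt p - net_entry d W L Wt' bt' p| <= e) ->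
  entries_close d W L Wt bt Wt' bt' e.
Proof.
move=> W0 pe l lL.
have lt_ldim i k : (i < ldim d W L k)%N -> (i < W + d)%N.
  by move=> /leq_trans; apply; exact: leq_ldim.
split=> [i j il jl|i il].
  have jW := lt_ldim _ _ jl.
  have := pe (Ordinal lL, (Ordinal (lt_ldim _ _ il), Ordinal (ltnW jW : (j < (W + d).+1)%N))).
  by rewrite /net_entry /= il jl -!val_eqE /= ltn_eqF.
have := pe (Ordinal lL, (Ordinal (lt_ldim _ _ il), ord_max)).
by rewrite /net_entry /= il eqxx.
Qed.

(** The shift by [B] makes the quotients nonnegative, where [Num.truncn] is the floor; equal floors
    place both numbers in one interval of length [e]. *)
Lemma truncn_eq_close {R : realType} (B e u v : R) : 0 < e -> `|u| <= B -> `|v| <= B ->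
  Num.truncn ((u + B) / e) = Num.truncn ((v + B) / e) -> `|u - v| <= e.
Proof.
rewrite !ler_norml => e0 /andP[u0 _] /andP[v0 _] uv.
have uB : 0 <= (u + B) / e by rewrite divr_ge0 ?(ltW e0)//; lra.
have vB : 0 <= (v + B) / e by rewrite divr_ge0 ?(ltW e0)//; lra.
have := truncn_itv uB; have := truncn_itv vB; rewrite uv -natr1.
move: (_%:R) => n /andP[]; rewrite ler_pdivlMr// ltr_pdivrMr// => v1 v2.
move=> /andP[]; rewrite ler_pdivlMr// ltr_pdivrMr// => u1 u2.
by apply/andP; split; lra.
Qed.

(* A network is coded by [S] pairs (position, quantised value) whose positions
   include every nonzero parameter; networks sharing a code are [e]-close. *)
Lemma covering_number_laplacian_le {R : realType} (d W L S : nat) (B e delta : R) :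
  (0 < W)%N -> (0 < L)%N -> 1 <= B -> 0 < e ->
  d%:R * ((40 * d.+1%:R * (W%:R * B)) ^+ (3 ^ L) * e) <= delta ->
  (covering_number d delta [set laplacian d F | F in Phi d L W S B] <=
    (((L * ((W + d) * (W + d).+1)) * (Num.truncn (2 * B / e)).+1) ^ S)%N%:R%:E)%E.
Proof.
move=> W0 L0 B1 e0 edelta; have B0 : 0 <= B by exact: le_trans B1.
(* Entries satisfy [u + B <= 2 * B], so [M] is the largest possible quantised value. *)
set M := Num.truncn (2 * B / e).
pose T := {ffun 'I_S -> ('I_L * ('I_(W + d) * 'I_(W + d).+1)) * 'I_M.+1}.
have <- : #|T| = (((L * ((W + d) * (W + d).+1)) * M.+1) ^ S)%N.
  by rewrite card_ffun !card_prod !card_ord.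
pose q (u : R) := Num.truncn ((u + B) / e).
pose code (f : 'rV[R]_d -> R) (t : T) := exists Wt bt,
  [/\ entries_bounded d W L Wt bt B, f = laplacian d (net d W L Wt bt),
      forall s, q (net_entry d W L Wt bt (t s).1) = (t s).2 :> nat &
      forall p, net_entry d W L Wt bt p != 0 -> exists s, (t s).1 = p].
apply: (@covering_number_le_card _ _ _ _ T code).
- exists (laplacian d (net d W L (fun _ _ _ => 0) (fun _ _ => 0))).
  exists (net d W L (fun _ _ _ => 0) (fun _ _ => 0)) => //.
  exists (fun _ _ _ => 0), (fun _ _ => 0); split; [|split=> //].
    by rewrite /nnz eqxx big1// => l _; rewrite !big1// => i _; rewrite big1.
  by move=> l _; split=> *; rewrite normr0.
- move=> _ [_ [Wt [bt [nS [WbB ->]]]] <-].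
  (* [p0] fills the slots left over once the support is exhausted. Its own quantised value is
     recorded there, so the code stays truthful. *)
  pose p0 : 'I_L * ('I_(W + d) * 'I_(W + d).+1) :=
    (Ordinal L0, (Ordinal (ltn_addr d W0), ord_max)).
  pose supp := enum [pred p | net_entry d W L Wt bt p != 0].
  pose t : T := [ffun s : 'I_S =>
    (nth p0 supp s, inord (q (net_entry d W L Wt bt (nth p0 supp s))))].
  exists t, Wt, bt; split=> // [s|p pn0].
    rewrite ffunE /= inordK// ltnS le_truncn// ler_wpM2r ?invr_ge0 ?(ltW e0)//.
    have := net_entry_bounded d W L B Wt bt (nth p0 supp s) B0 WbB.
    by rewrite ler_norml => /andP[_]; lra.
  have psupp : p \in supp by rewrite mem_enum.
  have iS : (index p supp < S)%N.
    apply: leq_trans nS; apply: leq_trans (card_net_entry_neq0 d W L Wt bt W0).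
    by rewrite cardE index_mem.
  by exists (Ordinal iS); rewrite ffunE /= nth_index.
- move=> f g t _ _ [Wt [bt [WbB -> tq ts]]] [Wt' [bt' [WbB' -> tq' ts']]].
  apply: supnorm_le => x Ox; apply: le_trans edelta.
  apply: laplacian_net_sub_le => //; first exact: ltW.
  apply: entries_close_net_entry => // p.
  (* A listed position has the same quantised value in both tables; an unlisted one is zero in
     both. *)
  have [[s <-]|nos] := pselect (exists s, (t s).1 = p).
    apply: (@truncn_eq_close _ B) => //; [exact: net_entry_bounded..|].
    by rewrite -![Num.truncn _]/(q _) tq tq'.
  have /eqP -> : net_entry d W L Wt bt p == 0 by apply: contra_notT nos; exact: ts.
  have /eqP -> : net_entry d W L Wt' bt' p == 0 by apply: contra_notT nos; exact: ts'.
  by rewrite subrr normr0 ltW.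
Qed.

(** * Counting the codes and taking logarithms *)

(** Positivity of [x] is replaced by [1 <= y]: for every [x <= 1], nonpositive ones included,
    [ln x <= 0 <= ln y]. *)
Lemma ln_le_of_le {R : realType} (x y : R) : 1 <= y -> x <= y -> ln x <= ln y.
Proof.
move=> y1 xy; have [x1|x1] := leP x 1; first by rewrite (le_trans (ln_le0 x1))// ln_ge0.
by rewrite ler_ln// posrE (lt_trans ltr01)// (lt_le_trans x1).
Qed.

(** With [X = G ^+ (3 ^ L)], the layers number at most [X], the positions in a layer at most
    [G * G], and the quantised values at most [G * G * X / delta]. *)
Lemma code_count_le {R : realType} (d W L : nat) (B delta G : R) :
  (0 < d)%N -> (0 < L)%N -> (2 <= W)%N -> 1 <= B -> 0 < delta -> delta < 1 ->
  G = 40 * d.+1%:R * (W%:R * B) ->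
  ((L * ((W + d) * (W + d).+1)) *
    (Num.truncn (2 * B / (delta / (d%:R * G ^+ (3 ^ L))))).+1)%N%:R <=
  G ^+ (6 * 3 ^ L) / delta.
Proof.
move=> d0 L0 W2 B1 delta0 delta1 GE.
have dR : 1 <= d%:R :> R by rewrite ler1n.
have WR : 2 <= W%:R :> R by rewrite (ler_nat _ 2).
(* This product supplies [W + d <= W * d + 1], the nonlinear fact needed to bound [W + d + 1] by
   [G]. *)
have WdR : 0 <= (W%:R - 1) * (d%:R - 1) :> R by rewrite mulr_ge0//; lra.
have WBW : W%:R * d.+1%:R <= W%:R * d.+1%:R * B by rewrite ler_peMr.
have WBB : B <= (W%:R * d.+1%:R) * B.
  rewrite ler_peMl//; first exact: le_trans B1.
  by rewrite mulr_ege1 ?ler1n// (leq_trans _ W2).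
rewrite -(natr1 d) in GE WBW WBB.
have {}GE : G = 40 * (W%:R * (d%:R + 1) * B) by rewrite GE; ring.
have GW1 : ((W + d).+1)%:R <= G by rewrite -(natr1 (W + d)) natrD; lra.
have GW : (W + d)%:R <= G by apply: le_trans GW1; rewrite ler_nat.
have GB : 3 * B <= G by lra.
have Gd : d%:R <= G by apply: le_trans GW; rewrite ler_nat leq_addl.
have G2 : 2 <= G by apply: le_trans GW; rewrite (ler_nat _ 2) ltn_addr// .
have G0 : 0 < G by apply: lt_le_trans G2.
have GL : L%:R <= G ^+ (3 ^ L).
  apply: (@le_trans _ _ (2 ^+ (3 ^ L))); last by rewrite lerXn2r// nnegrE// ltW.
  rewrite -natrX ler_nat (leq_trans (ltnW (ltn_expl L (isT : 1 < 3)%N)))//.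
  exact: ltnW (ltn_expl _ _).
have X0 : 0 < G ^+ (3 ^ L) by rewrite exprn_gt0.
have X1 : 1 <= G ^+ (3 ^ L) by rewrite exprn_ege1//; lra.
(* The exponent on the left is [2 * 3 ^ L + 4], and [4 <= 4 * 3 ^ L]. *)
have XG : G ^+ (3 ^ L) * (G * G) * (G * G * G ^+ (3 ^ L)) <= G ^+ (6 * 3 ^ L).
  apply: (@le_trans _ _ (G ^+ (2 * 3 ^ L + 4))).
    rewrite exprD mul2n -addnn exprD; move: (G ^+ (3 ^ L)) => X.
    by lra.
  rewrite ler_weXn2l//; first by lra.
  by rewrite -[X in (_ <= X * _)%N]/(2 + 4)%N mulnDl leq_add2l leq_pmulr ?expn_gt0.
move: (G ^+ (3 ^ L)) (G ^+ (6 * 3 ^ L)) GL X0 X1 XG => X X' GL X0 X1 XG.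
set e := delta / _.
have dX : 1 <= d%:R * X by rewrite mulr_ege1.
have e0 : 0 < e by rewrite divr_gt0// (lt_le_trans ltr01).
have BE : B / e = B * d%:R * X / delta.
  by rewrite /e; field; rewrite !gt_eqF// (lt_le_trans ltr01).
(* From [delta < 1]; it lets the successor after truncation be absorbed,
   [2 * B / e + 1 <= 3 * (B / e)]. *)
have Be1 : 1 <= B / e.
  rewrite ler_pdivlMr// mul1r /e ler_pdivrMr ?(lt_le_trans ltr01)//.
  by rewrite (le_trans (ltW delta1))// mulr_ege1.
have MR : (Num.truncn (2 * B / e)).+1%:R <= 3 * B * d%:R * X / delta.
  have -> : 3 * B * d%:R * X / delta = 3 * (B / e) by rewrite BE; ring.
  have : (Num.truncn (2 * B / e))%:R <= 2 * B / e.
    by rewrite truncn_le divr_ge0 ?(ltW e0)//; move: B1; lra.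
  by rewrite -(natr1 (Num.truncn _)) -mulrA; lra.
rewrite 3!natrM.
apply: (@le_trans _ _ (X * (G * G) * (G * G * X / delta))).
  have h : 0 <= 3 * B by lra.
  have D0 : 0 <= delta^-1 by rewrite invr_ge0 ltW.
  apply: ler_pM => //; first by apply: ler_pM => //; apply: ler_pM.
  by apply: le_trans MR _; rewrite !ler_wpM2r ?(ltW X0)//; apply: ler_pM.
by rewrite mulrA ler_pM2r ?invr_gt0.
Qed.

Theorem mainTheorem19 (R : realType) (d : nat) (c1 : R) :
  (0 < d)%N ->
  exists C : R, forall c2 : R, exists N0 : nat, forall N : nat, (N0 <= N)%N ->
  forall (L W S : nat) (B : R),
    (1 <= L)%N -> L%:R <= c1 ->
    (2 <= W)%N -> W%:R <= c2 * N%:R ->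
    S%:R <= c2 * N%:R ->
    1 <= B -> B <= c2 * N%:R ->
    forall delta : R, 0 < delta -> delta < 1 ->
      let A := [set laplacian d G | G in Phi d L W S B] in
      (covering_number d delta A < +oo)%E /\
      ln (fine (covering_number d delta A)) <=
        C * S%:R * (ln delta^-1 + 3 ^+ L * ln (W%:R * B)).
Proof.
(* The [6] is the exponent factor of the code count; the quotient converts the constant [40 * d.+1]
   inside [G] into a multiple of [ln (W * B)]. *)
move=> d0; exists (6 * (1 + ln (40 * d.+1%:R) / ln 2)) => c2; exists 0%N => N _.
move=> L W S B L1 _ W2 _ _ B1 _ delta delta0 delta1 A.
have W0 : (0 < W)%N by apply: leq_trans W2.
pose G : R := 40 * d.+1%:R * (W%:R * B).
have d1 : 1 <= d.+1%:R :> R by rewrite ler1n.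
have WR : 2 <= W%:R :> R by rewrite (ler_nat _ 2).
have Q2 : 2 <= W%:R * B by rewrite (le_trans WR)// ler_peMr// (le_trans _ WR).
have Q0 : 0 < W%:R * B by apply: lt_le_trans Q2.
have G1 : 1 <= G by rewrite /G -mulrA mulr_ege1// ?mulr_ege1//; lra.
have G0 : 0 < G by apply: lt_le_trans G1.
have dR : 0 < d%:R :> R by rewrite ltr0n.
pose X := G ^+ (3 ^ L).
have X0 : 0 < X by rewrite exprn_gt0.
pose e := delta / (d%:R * X).
have e0 : 0 < e by rewrite divr_gt0// mulr_gt0.
have ed : d%:R * (X * e) <= delta.
  by rewrite /e mulrA mulrC divfK// gt_eqF// mulr_gt0.
set K := ((L * ((W + d) * (W + d).+1)) * (Num.truncn (2 * B / e)).+1)%N.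
have cov : (covering_number d delta A <= ((K ^ S)%N%:R)%:E)%E.
  exact: covering_number_laplacian_le.
have cov0 : (0%:E <= covering_number d delta A)%E.
  by apply/ereal_infP => _ [n _ <-]; rewrite lee_fin.
have covfin : (covering_number d delta A < +oo)%E by rewrite (le_lt_trans cov)// ltry.
split=> //.
have K1 : 1 <= K%:R :> R by rewrite ler1n !muln_gt0 L1 addn_gt0 W0.
have /ln_le_of_le : fine (covering_number d delta A) <= (K ^ S)%N%:R.
  by rewrite -lee_fin fineK// ge0_fin_numE.
rewrite natrX => /(_ (exprn_ege1 _ K1)) /le_trans; apply.
rewrite lnXn ?(lt_le_trans ltr01)// -[leLHS]mulr_natr mulrAC ler_wpM2r//.
have KG : K%:R <= G ^+ (6 * 3 ^ L) / delta by exact: code_count_le.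
have /ln_le_of_le : K%:R <= G ^+ (6 * 3 ^ L) / delta by [].
move=> /(_ (le_trans K1 KG)) /le_trans; apply.
have lnG : ln G = ln (40 * d.+1%:R) + ln (W%:R * B).
  by rewrite /G lnM// posrE mulr_gt0// (lt_le_trans ltr01).
rewrite lnM ?posrE ?exprn_gt0 ?invr_gt0// lnXn// lnG.
have D0 : 0 <= ln delta^-1 by rewrite ln_ge0// invf_ge1// ltW.
set Q := W%:R * B in Q2 Q0 *.
have l2 : 0 < ln 2 :> R by rewrite ln_gt0// ltr1n.
have lQ : ln 2 <= ln Q by rewrite ler_ln// posrE.
have lH : 0 <= ln (40 * d.+1%:R : R) by rewrite ln_ge0// mulr_ege1//; lra.
set h := ln (40 * _) / ln 2.
(* Uses [ln 2 <= ln Q], which holds because [W >= 2] and [B >= 1]. *)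
have hE : ln (40 * d.+1%:R) <= h * ln Q.
  by rewrite -(divfK (lt0r_neq0 l2) (ln (40 * _))) ler_wpM2l// divr_ge0// ltW.
have h0 : 0 <= h by rewrite divr_ge0// ltW.
rewrite -[X in X + _ <= _]mulr_natl natrM natrX.
have : (3 : R) ^+ L * ln (40 * d.+1%:R) <= 3 ^+ L * (h * ln Q).
  by rewrite ler_wpM2l// exprn_ge0.
(* The count contributes [ln delta^-1] once and the target [6 * (1 + h)] times; the surplus is
   nonnegative. *)
have := mulr_ge0 h0 D0; lra.
Qed.
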